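(* Let $G$ be a graph, let $k$ and $t$ be integers with $1\le t\le k$, and let $S_1$ and $S_2$ be two disjoint subsets of $V(G)$ such that $S_1$ and $S_2$ are $k$-linked. If each $S_i$ has a subset $T_i$ of size $k-t$, for $i\in\{1,2\}$, such that $T_1$ and $T_2$ are $(k-t)$-linked, then there is a subset $T_i'\subseteq S_i\setminus T_i$ of size $t$ for each $i\in\{1,2\}$ such that $T_1\cup T_1'$ and $T_2\cup T_2'$ are $k$-linked.
   Context: Graphs are finite and simple. For an integer $m\ge 0$, two disjoint vertex subsets $A_1$ and $A_2$ of a graph $G$ are $m$-linked (in $G$) if there exist $m$ pairwise vertex-disjoint paths in $G$ joining $m$ distinct vertices of $A_1$ to $m$ distinct vertices of $A_2$ such that each of the $m$ paths meets $A_i$ in exactly one vertex for each $i\in\{1,2\}$. *)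

(* Defs.v *)
From mathcomp Require Import all_boot.

Set Implicit Arguments.
Unset Strict Implicit.
Unset Printing Implicit Defensive.

Record sgraph := SGraph {
  vertex :> finType;
  adj : rel vertex;
  adj_sym : symmetric adj;
  adj_irrefl : irreflexive adj }.

(* As in mathcomp's path.v, a path is given by its first vertex x and the
   sequence p of the remaining ones, so that its vertices are x :: p; the
   one-vertex path is the case p = [::]. *)
Definition path_between (G : sgraph) (x y : G) (p : seq G) : Prop :=
  [/\ path (@adj G) x p, last x p = y & uniq (x :: p)].

(* The i-th path has vertices a i :: p i and joins a i to b i. The notion is
   meant for disjoint A1 and A2. *)
Definition linked (G : sgraph) (m : nat) (A1 A2 : {set G}) : Prop :=
  exists (a b : 'I_m -> G) (p : 'I_m -> seq G),
    [/\ injective a /\ injective b,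
        forall i, [/\ a i \in A1, b i \in A2 & path_between (a i) (b i) (p i)],
        forall i j, i != j -> [disjoint a i :: p i & a j :: p j]
      & forall i, #|A1 :&: [set:: a i :: p i]| = 1 /\
                  #|A2 :&: [set:: a i :: p i]| = 1].

(* Main.v *)
(* Closing each path of a linkage from A1 to A2 up into a cycle and fixing all
   other vertices gives a permutation s of the vertices with s(A2) = A1 that
   moves each vertex outside A2 to a neighbour or not at all; conversely the
   orbits of the points of A1 under such an s, stopped at A2, form a linkage.
   The theorem thus becomes an exchange property of two permutations f (for
   T1, T2) and g (for S1, S2): when g has more ends than f, an alternating walk
   of the permutation f^-1 g frees one more end of f on each side, both of them
   ends of g, without freeing any end that f had. *)
Require Import Defs.
From mathcomp Require Import all_boot.
From mathcomp Require Import fingroup perm.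

Set Implicit Arguments.
Unset Strict Implicit.
Unset Printing Implicit Defensive.

(** On [A2] only the image is prescribed: which start follows which end stays open, so composing
    permutations may pair the ends anew. *)
Definition routing (G : sgraph) (s : {perm G}) (A1 A2 : {set G}) : Prop :=
  s @: A2 = A1 /\ {in ~: A2, forall v, s v = v \/ adj v (s v)}.

Lemma linked_routing (G : sgraph) (m : nat) (S1 S2 : {set G}) :
  linked m S1 S2 ->
  exists (A1 A2 : {set G}) (s : {perm G}),
    [/\ A1 \subset S1, A2 \subset S2, #|A2| = m & routing s A1 A2].
Proof.
case=> a [b [p [[a_inj b_inj] abp dis _]]].
pose P i := a i :: p i.
have P_uniq i : uniq (P i) by case: (abp i) => _ _ [].
have P_eq i j v : v \in P i -> v \in P j -> i = j.
  move=> vi vj; apply/eqP/idPn => /dis /disjointFr /(_ vi).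
  by rewrite -/(P j) vj.
pose f v := if [pick i | v \in P i] is Some i then next (P i) v else v.
have fP i v : v \in P i -> f v = next (P i) v.
  move=> vi; rewrite /f; case: pickP => [j vj|/(_ i)]; last by rewrite vi.
  by rewrite (P_eq _ _ _ vi vj).
(* As [f] preserves each path, injectivity can be checked on one path at a time. *)
have f_mem i v : (f v \in P i) = (v \in P i).
  rewrite {1}/f; case: pickP => // j vj; apply/idP/idP => [fvi|vi].
    by rewrite (P_eq i j (next (P j) v)) // mem_next.
  by rewrite (P_eq i j v) // mem_next.
have f_inj : injective f.
  move=> v w eq_f; have [i /= vi|no] := pickP [pred i | v \in P i]; last first.
    have fix_ u : (forall i, u \in P i = false) -> f u = u.
      by move=> nou; rewrite /f; case: pickP => // i; rewrite nou.
    rewrite -(fix_ v no) eq_f fix_ // => i.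
    by rewrite -f_mem -eq_f f_mem; apply: no.
  have wi : w \in P i by rewrite -f_mem -eq_f f_mem.
  by move: eq_f; rewrite !(fP i) //; apply: (can_inj (prev_next (P_uniq i))).
have b_mem i : b i \in P i by case: (abp i) => _ _ [_ <- _]; apply: mem_last.
have f_b i : f (b i) = a i.
  (* The index of the last vertex is out of range for [p i], and the default value of [nth] in
     [next] is the head [a i]: this closes the cycle. *)
  rewrite (fP i) // next_nth b_mem; apply: nth_default.
  case: (abp i) => _ _ [_ <- up].
  by rewrite /P index_last.
exists [set a i | i in 'I_m], [set b i | i in 'I_m], (perm f_inj); split.
- by apply/subsetP=> _ /imsetP[i _ ->]; case: (abp i).
- by apply/subsetP=> _ /imsetP[i _ ->]; case: (abp i).
- by rewrite card_imset // card_ord.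
split; first by rewrite -imset_comp; apply: eq_imset => i /=; rewrite permE.
move=> v; rewrite inE permE => v_nb.
have [i /= vi|no] := pickP [pred i | v \in P i]; last first.
  by left; rewrite /f; case: pickP => // i; have /= -> := no i.
right; rewrite (fP i) // next_nth vi.
have [_ _ [path_p last_p up]] := abp i.
have lt_v : index v (P i) < size (p i).
  rewrite ltnNge; apply: contra v_nb => le_p.
  have eq_i : index v (P i) = size (p i).
    by apply/eqP; rewrite eqn_leq le_p andbT -ltnS -[(size _).+1]/(size (P i)) index_mem.
  apply/imsetP; exists i => //.
  by rewrite -(nth_index (a i) vi) eq_i -last_p (last_nth (a i)).
by have /(pathP (a i)) /(_ _ lt_v) := path_p; rewrite -/(P i) nth_index.
Qed.

Lemma routing_linked (G : sgraph) (s : {perm G}) (A1 A2 : {set G}) :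
  routing s A1 A2 -> linked #|A1| A1 A2.
Proof.
move=> [sA adjs].
have A1P v : (s v \in A1) = (v \in A2) by rewrite -sA mem_imset //; apply: perm_inj.
pose a (i : 'I_#|A1|) : G := enum_val i.
have a_A1 i : a i \in A1 by apply: enum_valP.
have exit i : exists n, iter n s (a i) \in A2.
  (* [a i] is the image of some [v] in [A2]; going round its cycle ends at [v]. *)
  have := a_A1 i; rewrite -sA => /imsetP[v vA2 ->].
  exists (fingraph.order s v).-1; rewrite -iterSr prednK ?fingraph.order_gt0 //.
  by rewrite iter_order //; apply: perm_inj.
pose n i := ex_minn (exit i).
have nA2 i : iter (n i) s (a i) \in A2 by rewrite /n; case: ex_minnP.
have n_min i j : iter j s (a i) \in A2 -> n i <= j.
  by rewrite /n; case: ex_minnP => k _ + ?; apply.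
have a_inj : injective a by apply: enum_val_inj.
(* After its start the orbit meets A1 only right after having met A2. *)
have iterA1 i j : j <= n i -> iter j s (a i) \in A1 -> j = 0.
  case: j => // j lt_j; rewrite iterS A1P => /n_min.
  by rewrite leqNgt lt_j.
(* Where two stopped orbits meet, cancelling the common power of [s] puts a point of [A1] at step
   [j' - j] of one of them; by [iterA1] that step is 0. *)
have iter_eq i i' j j' : j <= j' -> j' <= n i' ->
    iter j s (a i) = iter j' s (a i') -> j = j' /\ i = i'.
  move=> le_j le_n; rewrite -{1}(subnKC le_j) iterD -!permX.
  move/perm_inj; rewrite permX => eq_a.
  have d0 : j' - j = 0.
    by apply: (iterA1 i'); rewrite -?eq_a //; apply: leq_trans le_n; apply: leq_subr.
  split; first by apply/eqP; rewrite eqn_leq le_j -subn_eq0 d0.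
  by apply: a_inj; rewrite eq_a d0.
pose p i := traject s (s (a i)) (n i).
have pE i : a i :: p i = traject s (a i) (n i).+1 by [].
exists a, (fun i => iter (n i) s (a i)), p; split.
- split=> // i i' eq_b; have [le_n|/ltnW le_n] := leqP (n i) (n i').
    by have [] := iter_eq _ _ _ _ le_n (leqnn _) eq_b.
  by have [] := iter_eq _ _ _ _ le_n (leqnn _) (esym eq_b).
- move=> i; split=> //.
  have p_uniq : uniq (a i :: p i).
    rewrite pE looping_uniq; apply/negP => /trajectP[j lt_j /esym eq_j].
    have [eq_jn _] := iter_eq _ _ _ _ (ltnW lt_j) (leqnn _) eq_j.
    by rewrite eq_jn ltnn in lt_j.
  split=> //; last by rewrite /p last_traject.
  apply/(pathP (a i)) => j; rewrite size_traject => lt_j.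
  rewrite -[nth _ (p i) j]/(nth (a i) (a i :: p i) j.+1) pE.
  rewrite (nth_traject s (leqW lt_j)) nth_traject ?ltnS // iterS.
  have [||//] := adjs (iter j s (a i)).
    by rewrite inE; apply: contraL lt_j => /n_min; rewrite -leqNgt.
  (* A fixed point would give the orbit equal vertices at steps [j] and [j.+1], both within reach of
     [iter_eq]. *)
  rewrite -iterS => /esym eq_j.
  by have [/n_Sn] := iter_eq _ _ _ _ (leqnSn j) lt_j eq_j.
- move=> i i' ne_i; apply/pred0P => v; apply/negP.
  rewrite /= !pE => /andP[/trajectP[j lt_j ->] /trajectP[j' lt_j' eq_v]].
  case/negP: ne_i; apply/eqP; have [le_j|/ltnW le_j] := leqP j j'.
    by have [] := iter_eq _ _ _ _ le_j lt_j' eq_v.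
  by have [] := iter_eq _ _ _ _ le_j lt_j (esym eq_v).
move=> i; split; apply/eqP/cards1P.
  exists (a i); apply/setP=> v; rewrite !inE -/(p i); apply/idP/eqP => [|->].
    rewrite -in_cons pE => /andP[+ /trajectP[j lt_j eq_v]].
    by rewrite eq_v => /iterA1 ->.
  by rewrite a_A1 eqxx.
exists (iter (n i) s (a i)); apply/setP=> v; rewrite !inE -in_cons pE.
apply/idP/eqP => [/andP[+ /trajectP[j lt_j eq_v]]|->].
  rewrite eq_v => /n_min le_n; congr (iter _ _ _).
  by apply/eqP; rewrite eqn_leq le_n -ltnS lt_j.
by rewrite nA2; apply/trajectP; exists (n i).
Qed.

(* This replaces following an alternating walk from a point of A :\: T by an
   induction that contracts one step z -> y = s z of it: after the contraction
   y is a fixed point and z takes its place in A. Since #|T| < #|A|, some walk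
   does not end in T. *)
Lemma perm_exchange (V : finType) (s : {perm V}) (T A : {set V}) :
  #|T| < #|A| ->
  exists (c : {perm V}) (x y : V),
    [/\ y \in A :\: T, x \in (s @: A) :\: T, c @: (y |: T) = x |: T
      & forall v, v \notin y |: T -> c v = v \/ v \notin A /\ c v = s v].
Proof.
have [n] := ubnP #|[set v | s v != v]|.
elim: n => // n IH in s A * => le_n lt_TA.
have [y /and3P[yA yT ysA]|none] :=
  pickP [pred y | [&& y \in A, y \notin T & y \in s @: A]].
  exists 1%g, y, y; split; rewrite ?inE ?yA ?yT //.
    by rewrite (eq_imset _ (@perm1 V)) imset_id.
  by move=> v _; left; rewrite perm1.
(* Otherwise the preimage of [A :\: T] under [s] lies in [T :\: A], against [#|T| < #|A|]. *)
have [z [zA zT szA szT]] :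
    exists z, [/\ z \notin A, z \notin T, s z \in A & s z \notin T].
  have [z /and3P[? ? /andP[]]|none'] :=
    pickP [pred z | [&& z \notin A, z \notin T, s z \in A & s z \notin T]].
    by exists z.
  have: #|A :\: T| <= #|T :\: A|.
    rewrite -(card_preimset (A :\: T) (@perm_inj _ s)).
    apply/subset_leq_card/subsetP=> z; rewrite !inE => /andP[szT szA].
    have /= := none (s z); rewrite szA szT mem_imset; last exact: perm_inj.
    move=> /= zA; have /= := none' z; rewrite zA szA szT /= andbT => /negbFE ->.
    by [].
  rewrite leqNgt => /negP[].
  by rewrite -(ltn_add2l #|A :&: T|) {1}setIC !cardsID.
pose y := s z; pose s' := (tperm y z * s)%g; pose A' := z |: A :\ y.
have neq_yz : y != z by apply: contraNneq zA => <-.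
have s'y : s' y = y by rewrite permM tpermL.
have s'E v : v != y -> v != z -> s' v = s v.
  by move=> vy vz; rewrite permM tpermD 1?eq_sym.
have s'A : s' @: A' = s @: A.
  rewrite -(setD1K szA) !imsetU1 {1}permM tpermR; congr (_ |: _).
  apply: eq_in_imset => v; rewrite !inE => /andP[vy vA].
  by apply: s'E => //; apply: contraNneq zA => <-.
have [||c [x [y' [y'A x_in cT cP]]]] := IH s' A'.
(* The induction is on the number of moved points: [s'] fixes [y], which [s] moves, and moves no new
   point. *)
- rewrite -ltnS; apply: leq_trans le_n; rewrite ltnS; apply: proper_card.
  apply/properP; split; last first.
    exists y; rewrite !inE ?s'y ?eqxx //.
    by rewrite (inj_eq (@perm_inj _ s)).
  apply/subsetP=> v; rewrite !inE; have [->|vy] := eqVneq v y.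
    by rewrite s'y eqxx.
  by have [->|vz] := eqVneq v z; [rewrite -/y neq_yz | rewrite s'E].
- by rewrite -(card_imset A' (@perm_inj _ s')) s'A card_imset //; apply: perm_inj.
have c_y : y != y' -> c y = y.
  move=> ne; have [|//|[_ ->]//] := cP y.
  by rewrite !inE negb_or ne.
rewrite s'A in x_in.
(* If the walk uses [z] as its end in [A'], the contracted step is put back: [y] takes over the
   image of [z], and [z] goes to [y = s z]. Otherwise [c] serves unchanged, since it follows [s']
   only outside [A'], hence never at [z], and fixes [y] if it follows [s'] there. *)
have [eq_y'|ne_y'] := eqVneq y' z.
  exists (tperm y z * c)%g, x, y; split=> //.
  - by rewrite !inE szA szT.
  - rewrite (eq_imset _ (permM _ c)) imset_comp -cT eq_y' imsetU1 tpermL.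
    congr (_ @: (_ |: _)); rewrite -[RHS]imset_id; apply: eq_in_imset => v vT.
    by apply: tpermD; apply: contraTneq vT => <-.
  move=> v; rewrite !inE negb_or => /andP[vy vT]; rewrite permM.
  have [->|vz] := eqVneq v z.
    by right; rewrite tpermR c_y // eq_y'.
  rewrite tpermD 1?eq_sym //.
  have [|->|[vA' ->]] := cP v; [|by left|right].
    by rewrite !inE eq_y' negb_or vz.
  split; first by apply: contra vA' => vA; rewrite !inE vy vA orbT.
  by rewrite s'E.
exists c, x, y'; split=> //.
  by move: y'A; rewrite !inE (negPf ne_y') /= => /and3P[-> _ ->].
move=> v vT; have [->|vA'] := cP v vT; first by left.
have [eq_v|vy] := eqVneq v y; first by left; case: vA' => _ ->; rewrite eq_v.
case: vA'; rewrite !inE vy negb_or /= => /andP[vz vA] ->; right.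
by rewrite s'E.
Qed.

(** With [c] from [perm_exchange] for [g * f^-1] (first [g], then [f^-1]), the product [c * f] steps
    like [f] where [c] fixes a vertex and like [g] where [c] follows the walk, so outside the new
    end set every step is legal. *)
Lemma routing_augment (G : sgraph) (f g : {perm G}) (T1 T2 A1 A2 : {set G}) :
  routing f T1 T2 -> routing g A1 A2 -> #|T2| < #|A2| ->
  exists (h : {perm G}) (x y : G),
    [/\ x \in A1 :\: T1, y \in A2 :\: T2 & routing h (x |: T1) (y |: T2)].
Proof.
move=> [fT fadj] [gA gadj].
move=> /(perm_exchange (g * f^-1)%g) [c [x [y [yA xA cT cP]]]].
(* [f] carries [(g * f^-1) @: A2] onto [A1] and [T2] onto [T1], so the new start is [f x]. *)
exists (c * f)%g, (f x), y; split=> //.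
  move: xA; rewrite -fT -gA !inE => /andP[xT /imsetP[v vA x_v]].
  rewrite mem_imset; last exact: perm_inj.
  by rewrite xT x_v permM permKV imset_f.
split.
  rewrite (eq_imset _ (permM c f)) imset_comp cT imsetU1.
  by rewrite fT.
move=> v; rewrite inE permM => vT; case: (cP v vT) => [->|[vA ->]].
  by apply: fadj; move: vT; rewrite !inE negb_or => /andP[].
by rewrite permM permKV; apply: gadj; rewrite inE.
Qed.

Lemma routing_extend (G : sgraph) (t : nat) (f g : {perm G})
    (T1 T2 A1 A2 : {set G}) :
  routing f T1 T2 -> routing g A1 A2 -> #|T2| + t <= #|A2| ->
  exists (h : {perm G}) (T1' T2' : {set G}),
    [/\ T1' \subset A1 :\: T1, T2' \subset A2 :\: T2, #|T1'| = t, #|T2'| = t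
      & routing h (T1 :|: T1') (T2 :|: T2')].
Proof.
move=> fT gA; elim: t => [|t IH] le_A.
  by exists f, set0, set0; rewrite !sub0set !cards0 !setU0.
have [|h [U1 [U2 [U1A U2A cU1 cU2 hU]]]] := IH.
  by apply: leq_trans le_A; rewrite addnS.
(* The same [g] thus serves for every augmentation. *)
have lt_A : #|T2 :|: U2| < #|A2|.
  apply: leq_trans le_A; rewrite addnS ltnS -cU2 cardsU; exact: leq_subr.
have [h' [x [y [xA yA hU']]]] := routing_augment hU gA lt_A.
move: xA yA; rewrite !inE !negb_or => /andP[/andP[xT xU] xA] /andP[/andP[yT yU] yA].
exists h', (x |: U1), (y |: U2); split.
- by rewrite subUset sub1set U1A !inE xT xA.
- by rewrite subUset sub1set U2A !inE yT yA.
- by rewrite cardsU1 xU cU1.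
- by rewrite cardsU1 yU cU2.
by rewrite !(setUCA _ [set _]).
Qed.

Theorem theorem2p3 (G : sgraph) (k t : nat) (S1 S2 T1 T2 : {set G}) :
  1 <= t <= k ->
  [disjoint S1 & S2] ->
  linked k S1 S2 ->
  T1 \subset S1 -> T2 \subset S2 ->
  #|T1| = k - t -> #|T2| = k - t ->
  linked (k - t) T1 T2 ->
  exists T1' T2' : {set G},
    [/\ T1' \subset S1 :\: T1 /\ T2' \subset S2 :\: T2,
        #|T1'| = t /\ #|T2'| = t
      & linked k (T1 :|: T1') (T2 :|: T2')].
Proof.
move=> /andP[_ le_tk] _ /linked_routing[A1 [A2 [g [A1S A2S cA2 gA]]]] _ _ cT1 cT2.
move=> /linked_routing[U1 [U2 [f [U1T U2T cU2 fU]]]].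
(* The ends of the smaller linkage exhaust [T1] and [T2] by cardinality, so augmenting keeps all of
   both sets. *)
have eqU2 : U2 = T2 by apply/eqP; rewrite eqEcard U2T cT2 cU2 leqnn.
have eqU1 : U1 = T1.
  apply/eqP; rewrite eqEcard U1T cT1 -cU2; case: fU => <- _.
  by rewrite (card_imset _ (@perm_inj _ f)) leqnn.
rewrite eqU1 eqU2 in fU.
have [|h [T1' [T2' [T1'A T2'A c1 c2 hT]]]] := routing_extend fU gA (t := t).
  by rewrite cT2 cA2 subnK.
exists T1', T2'; split=> //.
  by split; [apply: subset_trans T1'A _ | apply: subset_trans T2'A _]; apply: setSD.
have <- : #|T1 :|: T1'| = k; last exact: routing_linked hT.
rewrite cardsU c1 cT1 (_ : T1 :&: T1' = set0) ?cards0 ?subn0 ?subnK //.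
by apply: disjoint_setI0; rewrite disjoint_sym; move: T1'A; rewrite subsetD => /andP[].
Qed.
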